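(* Let $D$ be a Borel data structure, $\mathcal{X}$ a Borel space and $I$ an indexing system with skeleton $(I_{\mathrm{rep}},r,\pi_\bullet)$. A one-to-one correspondence between (1) natural transformations $\eta:D\to\mathrm{ARRAY}(\mathcal{X},I)$, and (2) families $(f_{\mathbf{j}})_{\mathbf{j}\in I_{\mathrm{rep}}}$ such that for every $\mathbf{j}\in I_{\mathrm{rep}}$ with $k=|\mathbf{j}|$, $f_{\mathbf{j}}:D_{\{1,\dots,k\}}\to\mathcal{X}$ is measurable with $f_{\mathbf{j}}=f_{\mathbf{j}}\circ D[\pi]$ for every $\pi\in\mathrm{stab}(\mathbf{j})$, is given by - $\eta\mapsto(f_{\mathbf{j}})_{\mathbf{j}\in I_{\mathrm{rep}}}$ with $f_{\mathbf{j}}=\eta_{[k],\mathbf{j}}$, $k=|\mathbf{j}|$; - $(f_{\mathbf{j}})_{\mathbf{j}\in I_{\mathrm{rep}}}\mapsto\eta$ with $\eta_{a,\mathbf{i}}=f_{r(\mathbf{i})}\circ D[\pi_{\mathbf{i}}]\circ D[\iota_{\mathrm{dom}(\mathbf{i}),a}]$ for $a$ finite and $\mathbf{i}\in I_a$. Here $\eta_{a,\mathbf{i}}:D_a\to\mathcal{X}$ is the $\mathbf{i}$-th coordinate of $\eta_a:D_a\to\mathcal{X}^{I_a}$. Further, the construction $(f_{\mathbf{j}})_{\mathbf{j}\in I_{\mathrm{rep}}}\mapsto\eta$ does not depend on the concrete choice of $\pi_\bullet$.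
   Context: $[k]=\{1,\dots,k\}$, $[0]=\emptyset$; for $b'\subseteq b$, $\iota_{b',b}$ is the inclusion. A Borel space is a measurable space admitting a bi-measurable bijection onto a Borel subset of $[0,1]$. A Borel data structure (BDS) $D$ is a rule mapping every finite set $a$ to a Borel space $D_a$ and every injection $\tau:b\to a$ between finite sets to a measurable map $D[\tau]:D_a\to D_b$, with $D[\mathrm{id}_a]=\mathrm{id}_{D_a}$ and $D[\sigma\circ\tau]=D[\tau]\circ D[\sigma]$. A natural transformation $\eta:D\to E$ of BDS is a rule sending every finite set $a$ to a measurable map $\eta_a:D_a\to E_a$ with $\eta_b\circ D[\tau]=E[\tau]\circ\eta_a$ for every injection $\tau:b\to a$. (''Rules'' on all finite sets: NBG with global choice, or inside a fixed Grothendieck universe.) An indexing system $I$ is a rule mapping every finite set $b$ to a finite set $I_b$ and every injection $\tau:b\to a$ to an injection $I[\tau]:I_b\to I_a$ such that (1) $I[\sigma\circ\tau]=I[\sigma]\circ I[\tau]$; (2) $I_b\cap I_a=I_{b\cap a}$; (3) $I[\iota_{b',b}]=\iota_{I_{b'},I_b}$ for $b'\subseteq b$. $\mathrm{ARRAY}(\mathcal{X},I)$ is the BDS $D_a=\mathcal{X}^{I_a}$, $D[\tau](x)=x\circ I[\tau]$. An index of $I$ is an element $\mathbf{i}\in I_b$ for some finite $b$. $\mathrm{dom}(\mathbf{i})=\bigcap_{b'\subseteq b,\ \mathbf{i}\in I_{b'}}b'$ (independent of $b$), $|\mathbf{i}|=|\mathrm{dom}(\mathbf{i})|$, $\mathrm{stab}(\mathbf{i})$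 is the group of bijections $\pi:\mathrm{dom}(\mathbf{i})\to\mathrm{dom}(\mathbf{i})$ with $I[\pi](\mathbf{i})=\mathbf{i}$, and $\mathbf{i}\sim\mathbf{i}'$ iff $I[\tau](\mathbf{i})=\mathbf{i}'$ for some injection $\tau$ (an equivalence relation). A skeleton of $I$ is a triple $(I_{\mathrm{rep}},r,\pi_\bullet)$: $I_{\mathrm{rep}}$ is a set of indices such that every index is equivalent to exactly one element of $I_{\mathrm{rep}}$ and every $\mathbf{j}\in I_{\mathrm{rep}}$ has $\mathrm{dom}(\mathbf{j})=[k]$, $k=|\mathbf{j}|$; $r$ maps every index $\mathbf{i}$ to the unique $r(\mathbf{i})\in I_{\mathrm{rep}}$ with $\mathbf{i}\sim r(\mathbf{i})$; $\pi_\bullet$ maps every index $\mathbf{i}$ with $k=|\mathbf{i}|$ to a bijection $\pi_{\mathbf{i}}:[k]\to\mathrm{dom}(\mathbf{i})$ with $I[\pi_{\mathbf{i}}](r(\mathbf{i}))=\mathbf{i}$. *)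

(* Defs.v *)
From HB Require Import structures.
From mathcomp Require Import all_boot all_order all_algebra.
From mathcomp Require Import finmap.
From mathcomp Require Import all_classical all_reals all_analysis.

Set Implicit Arguments.
Unset Strict Implicit.
Unset Printing Implicit Defensive.

Import Order.TTheory GRing.Theory Num.Theory.

Local Open Scope classical_set_scope.
Local Open Scope ring_scope.

(** * Measurable spaces *)

(* The library's [measurableType] is pointed, hence never empty, whereas the
   empty space is a Borel space; a measurable space is therefore taken to be a
   bare type with a sigma-algebra. *)
Record mspace := MSpace {
  mcarrier :> Type;
  mset : set (set mcarrier);
  msetP : sigma_algebra setT mset }.

Definition mmap (E F : mspace) (f : E -> F) : Prop :=
  forall B, mset B -> mset (f @^-1` B).

(* Measurability of the inverse [S -> E] for the trace sigma-algebra on [S] is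
   expressed by direct images, [S] being Borel. *)
Definition borel_space (R : realType) (E : mspace) : Prop :=
  exists (S : set R) (f : E -> R),
    [/\ measurable S, S `<=` `[0, 1]%classic, set_bij setT S f,
        forall B : set R, measurable B -> mset (f @^-1` B) &
        forall A : set E, mset A -> measurable (f @` A)].

Definition power_mset (J : Type) (E : mspace) : set (set (J -> E)) :=
  <<s [set A | exists (j : J) (B : set E),
         mset B /\ A = (fun x : J -> E => x j) @^-1` B] >>.

Lemma power_msetP (J : Type) (E : mspace) :
  sigma_algebra setT (@power_mset J E).
Proof. exact: smallest_sigma_algebra. Qed.

Definition power_mspace (J : Type) (E : mspace) : mspace :=
  MSpace (@power_msetP J E).

Lemma mmap_power (E F : mspace) (J : Type) (f : E -> power_mspace J F) :
  (forall j, mmap (fun x => f x j)) -> mmap f.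
Proof.
move=> fP; pose G : set (set (J -> F)) := [set A | mset (f @^-1` A)].
suff sG : sigma_algebra setT G.
  by move=> A mA; apply: (mA G); split=> // _ [j [B [mB ->]]]; exact: fP.
have [E0 EC EU] := msetP E; split; rewrite /G /=.
- by rewrite preimage_set0.
- by move=> A mA; rewrite setTD preimage_setC -setTD; exact: EC.
- by move=> A mA; rewrite preimage_bigcup; exact: EU.
Qed.

Lemma mmap_coord (E : mspace) (J : Type) (j : J) :
  mmap (fun x : power_mspace J E => x j).
Proof.
by move=> B mB; apply: sub_gen_smallest; exists j, B.
Qed.

Local Close Scope classical_set_scope.
Local Open Scope fset_scope.

(** * Finite sets and injections *)

(* The "universe" whose finite subsets are the finite sets under consideration;
   it contains the natural numbers, so that the sets [{1, ..., k}] make sense.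
   For a Grothendieck universe, its finite subsets are all the
   finite sets of the universe. *)
Record labels := Labels {
  label :> choiceType;
  num : nat -> label;
  num_inj : injective num }.

Definition segment (U : labels) (k : nat) : {fset U} :=
  [fset num U m | m in iota 1 k].

Lemma card_segment (U : labels) k : #|` segment U k| = k.
Proof.
rewrite card_imfset /=; last exact: num_inj.
by rewrite undup_id ?iota_uniq // size_iota.
Qed.

Record finj (T : choiceType) (b a : {fset T}) := Finj {
  finj_fun :> b -> a;
  finj_inj : injective finj_fun }.

Lemma finjP (T : choiceType) (b a : {fset T}) (s t : finj b a) :
  (forall x, s x = t x) -> s = t.
Proof.
case: s t => [s si] [t ti] /= st; have {}st : s = t by apply/funext.
by subst t; congr Finj; exact: Prop_irrelevance.
Qed.

Definition finj_id (T : choiceType) (a : {fset T}) : finj a a :=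
  @Finj T a a id (@inj_id a).

Definition finj_comp (T : choiceType) (c b a : {fset T})
    (s : finj b a) (t : finj c b) : finj c a :=
  Finj (inj_comp (@finj_inj _ _ _ s) (@finj_inj _ _ _ t)).

Definition finj_incl (T : choiceType) (b a : {fset T}) (ba : b `<=` a) :
    finj b a :=
  Finj (@fincl_inj _ _ _ ba).

(** * Borel data structures *)

(* Naturality does not involve the Borel condition, which is kept apart from
   the functor; a Borel data structure [BDS] combines the two. *)
Record data_structure (U : choiceType) := DataStructure {
  ds_obj :> {fset U} -> mspace;
  ds_map : forall b a : {fset U}, finj b a -> ds_obj a -> ds_obj b;
  ds_mmap : forall (b a : {fset U}) (t : finj b a), mmap (ds_map t);
  ds_id : forall (a : {fset U}) (x : ds_obj a), ds_map (finj_id a) x = x;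
  ds_comp : forall (c b a : {fset U}) (s : finj b a) (t : finj c b)
      (x : ds_obj a), ds_map (finj_comp s t) x = ds_map t (ds_map s x) }.

Record BDS (R : realType) (U : choiceType) := BorelDS {
  bds_ds :> data_structure U;
  bds_borel : forall a, borel_space R (bds_ds a) }.

Definition is_natural (U : choiceType) (D E : data_structure U)
    (eta : forall a : {fset U}, D a -> E a) : Prop :=
  (forall a, mmap (eta a)) /\
  (forall (b a : {fset U}) (t : finj b a) (x : D a),
     eta b (ds_map t x) = ds_map t (eta a x)).

(** * Indexing systems *)

Record indexing_system (U W : choiceType) := IndexingSystem {
  is_obj :> {fset U} -> {fset W};
  is_map : forall b a : {fset U}, finj b a -> finj (is_obj b) (is_obj a);
  is_comp : forall (c b a : {fset U}) (s : finj b a) (t : finj c b),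
    is_map (finj_comp s t) = finj_comp (is_map s) (is_map t);
  is_cap : forall b a : {fset U}, is_obj b `&` is_obj a = is_obj (b `&` a);
  is_incl : forall (b' b : {fset U}) (bb : b' `<=` b) (i : is_obj b'),
    fsval (is_map (finj_incl bb) i) = fsval i }.

Lemma is_map_id (U W : choiceType) (I : indexing_system U W) (a : {fset U})
    (i : I a) : is_map I (finj_id a) i = i.
Proof.
apply: val_inj; rewrite -[RHS](is_incl (fsubset_refl a)).
by congr (fsval (is_map I _ i)); apply: finjP => x; exact: val_inj.
Qed.

Section Array.
Context (U W : choiceType) (X : mspace) (I : indexing_system U W).

Definition array_map (b a : {fset U}) (t : finj b a)
    (x : power_mspace (I a) X) : power_mspace (I b) X :=
  x \o is_map I t.

Lemma array_mmap (b a : {fset U}) (t : finj b a) : mmap (array_map t).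
Proof. by apply: mmap_power => j; exact: mmap_coord. Qed.

Lemma array_id (a : {fset U}) (x : power_mspace (I a) X) :
  array_map (finj_id a) x = x.
Proof. by apply/funext => i; rewrite /array_map /= is_map_id. Qed.

Lemma array_comp (c b a : {fset U}) (s : finj b a) (t : finj c b)
    (x : power_mspace (I a) X) :
  array_map (finj_comp s t) x = array_map t (array_map s x).
Proof. by apply/funext => i; rewrite /array_map /= is_comp. Qed.

Definition array : data_structure U :=
  DataStructure array_mmap array_id array_comp.

End Array.

Section Index.
Context (U W : choiceType) (I : indexing_system U W).

Record indexT := Index {
  ival :> W;
  ivalP : exists b : {fset U}, ival \in I b }.

Definition index_of (a : {fset U}) (i : I a) : indexT :=
  @Index (fsval i) (ex_intro _ a (fsvalP i)).

Definition idom_in (b : {fset U}) (i : W) : {fset U} :=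
  \big[@fsetI U/b]_(b' <- fpowerset b | i \in I b') b'.

(* The set [b] with [i \in I b] is chosen; see [idom_inE]. *)
Definition idom (i : indexT) : {fset U} := idom_in (projT1 (cid (ivalP i))) i.

Definition arity (i : indexT) : nat := #|` idom i|.

(* [i \in I b] and [I[t](i) = i']. *)
Definition sends (b a : {fset U}) (t : finj b a) (i i' : W) : Prop :=
  exists ib : i \in I b, fsval (is_map I t [` ib]) = i'.

Definition iequiv (i i' : indexT) : Prop :=
  exists (b a : {fset U}) (t : finj b a), sends t i i'.

Definition stab (i : indexT) (p : finj (idom i) (idom i)) : Prop :=
  bijective p /\ sends p i i.

Lemma idom_in_mem b (i : W) : i \in I b -> i \in I (idom_in b i).
Proof.
move=> ib; rewrite /idom_in.
by elim/big_ind: _ => // x y ix iy; rewrite -is_cap in_fsetI ix.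
Qed.

Lemma idom_in_sub b c (i : W) : i \in I b -> i \in I c -> idom_in b i `<=` c.
Proof.
move=> ib ic; apply: (fsubset_trans _ (fsubsetIr b c)).
have : b `&` c \in fpowerset b by rewrite fpowersetE fsubsetIl.
have : i \in I (b `&` c) by rewrite -is_cap in_fsetI ib.
rewrite /idom_in; move: (b `&` c) => e ie.
rewrite -[e \in _]/(e \in enum_fset (fpowerset b)).
elim: (enum_fset (fpowerset b)) => // x s IH.
rewrite big_cons inE => /predU1P[<-|/IH es]; first by rewrite ie fsubsetIl.
by case: ifP => // _; exact: fsubset_trans (fsubsetIr _ _) es.
Qed.

Lemma idom_mem (i : indexT) : ival i \in I (idom i).
Proof. by rewrite /idom; case: cid => b ib /=; exact: idom_in_mem. Qed.

Lemma idom_sub (i : indexT) c : ival i \in I c -> idom i `<=` c.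
Proof. by rewrite /idom; case: cid => b ib /=; exact: idom_in_sub. Qed.

Lemma idom_inE (i : indexT) b : ival i \in I b -> idom_in b i = idom i.
Proof.
move=> ib; apply/eqP; rewrite eqEfsubset; apply/andP; split.
  exact: idom_in_sub ib (idom_mem i).
by apply: idom_sub; exact: idom_in_mem.
Qed.

Lemma sends_bij b a (t : finj b a) (i i' : indexT) :
  sends t i i' ->
  exists (c : {fset U}) (s : finj (idom i) c) (s' : finj c (idom i)),
    [/\ #|` c| = arity i, sends s i i' & sends s' i' i].
Proof.
move=> [ib ti]; pose d := idom i; have db : d `<=` b by exact: idom_sub.
pose h (x : d) : U := fsval (t (fincl db x)).
have h_inj : injective h.
  by move=> x y /val_inj /finj_inj /fincl_inj.
pose c : {fset U} := [fset h x | x : d].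
have hc (x : d) : h x \in c by apply/imfsetP; exists x.
pose s : finj d c := @Finj _ d c (fun x => [` hc x])
  (fun x y e => h_inj _ _ (congr1 (@fsval _ _) e)).
have card_c : #|` c| = arity i.
  by rewrite card_imfset //= -cardE -cardfE.
have ca : c `<=` a by apply/fsubsetP => _ /imfsetP[x _ ->]; exact: fsvalP.
have si : sends s i i'.
  exists (idom_mem i); rewrite -ti -(is_incl ca).
  have -> : [` ib] = is_map I (finj_incl db) [` idom_mem i].
    by apply: val_inj => /=; rewrite is_incl.
  rewrite -[LHS]/(fsval (finj_comp _ _ _)) -[RHS]/(fsval (finj_comp _ _ _)).
  rewrite -!is_comp; congr (fsval (is_map I _ _)).
  by apply: finjP => x; exact: val_inj.
have [g sK gK] : bijective s.
  apply: inj_card_bij (@finj_inj _ _ _ s) _.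
  by rewrite -!cardfE card_c.
pose s' : finj c d := Finj (can_inj gK).
exists c, s, s'; split=> //; case: si => id si.
have ic : ival i' \in I c by rewrite -si; exact: fsvalP.
exists ic; have -> : [` ic] = is_map I s [` id] by apply: val_inj.
rewrite -[LHS]/(fsval (finj_comp _ _ _)) -is_comp.
have -> : finj_comp s' s = finj_id d by apply: finjP => x /=; rewrite sK.
by rewrite is_map_id.
Qed.

Lemma arity_equiv (i i' : indexT) : iequiv i i' -> arity i = arity i'.
Proof.
move=> [b [a [t /sends_bij [c [s [s' [cE [id si] s'i]]]]]]].
have le b1 a1 (t1 : finj b1 a1) (j j' : indexT) :
    sends t1 j j' -> (arity j' <= arity j)%N.
  move=> /sends_bij [c1 [s1 [_ [<- [jd sj] _]]]].
  by apply: fsubset_leq_card; apply: idom_sub; rewrite -sj; exact: fsvalP.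
by apply/eqP; rewrite eqn_leq (le _ _ _ _ _ s'i) (le _ _ s) //; exists id.
Qed.

End Index.

(** * Skeletons *)

Record representatives (U : labels) (W : choiceType)
    (I : indexing_system U W) := Representatives {
  rep_set : set (indexT I);
  rep_uniq : forall i : indexT I, exists! j, rep_set j /\ iequiv i j;
  rep_dom : forall j, rep_set j -> idom j = segment U (arity j);
  rep : indexT I -> rep_set;
  rep_equiv : forall i, iequiv i (val (rep i)) }.

Record transports (U : labels) (W : choiceType) (I : indexing_system U W)
    (S : representatives I) := Transports {
  tr : forall i : indexT I, finj (segment U (arity i)) (idom i);
  tr_bij : forall i, bijective (tr i);
  tr_sends : forall i, sends I (tr i) (val (rep S i)) i }.

Record skeleton (U : labels) (W : choiceType) (I : indexing_system U W) :=
  Skeleton {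
    sk_rep :> representatives I;
    sk_tr : transports sk_rep }.

Section Correspondence.
Context (U : labels) (W : choiceType) (D : data_structure U) (X : mspace)
  (I : indexing_system U W).

Definition comp_family (S : representatives I) : Type :=
  forall j : rep_set S, D (segment U (arity (val j))) -> X.

Lemma rep_domE (S : representatives I) (j : rep_set S) :
  idom (val j) = segment U (arity (val j)).
Proof. by apply: rep_dom; exact: set_valP. Qed.

Lemma rep_mem (S : representatives I) (j : rep_set S) :
  ival (val j) \in I (segment U (arity (val j))).
Proof. by rewrite -rep_domE; exact: idom_mem. Qed.

Lemma arity_rep (S : representatives I) (i : indexT I) :
  arity (val (rep S i)) = arity i.
Proof. by apply/esym/arity_equiv; exact: rep_equiv. Qed.

(* A permutation of [idom j] is read as a permutation of [{1, ..., |j|}] along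
   the equality of these two sets. *)
Definition is_invariant (S : representatives I) (f : comp_family S) : Prop :=
  forall j : rep_set S,
    mmap (f j) /\
    forall p : finj (idom (val j)) (idom (val j)), stab p ->
      f j = f j \o ds_map (ecast c (finj c c) (rep_domE j) p).

Definition to_family (S : representatives I)
    (eta : forall a : {fset U}, D a -> array X I a) : comp_family S :=
  fun j x => eta (segment U (arity (val j))) x [` rep_mem j].

(* The cast is along [|r(i)| = |i|]. *)
Definition of_family (S : skeleton I) (f : comp_family S) (a : {fset U})
    (x : D a) : array X I a :=
  fun i : I a =>
    let i' := index_of i in
    (ecast k (D (segment U k) -> X) (arity_rep S i') (f (rep S i')))
      (ds_map (tr (sk_tr S) i')
        (ds_map (finj_incl (idom_sub (i := i') (fsvalP i))) x)).

End Correspondence.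

(* Main.v *)
(** A representative [j] has domain [[k]], so [eta_{[k], j}] determines
    [eta_{a, i}] for every [i] in the class of [j], by naturality along any
    injection [t : [k] -> a] with [I[t](j) = i].  Conversely, two such
    injections both have range [dom(i)], hence differ by an element of
    [stab(j)], and the invariance of [f_j] makes [f_j \o D[t]] independent of
    [t].  Naturality, the two inverse laws and the independence of the
    transports are all instances of this. *)

Require Import Defs.
From HB Require Import structures.
From mathcomp Require Import all_boot all_order all_algebra.
From mathcomp Require Import finmap.
From mathcomp Require Import all_classical all_reals all_analysis.

Set Implicit Arguments.
Unset Strict Implicit.
Unset Printing Implicit Defensive.

Local Open Scope fset_scope.

Lemma mmap_comp (E F G : mspace) (g : F -> G) (f : E -> F) :
  mmap g -> mmap f -> mmap (g \o f).
Proof. by move=> mg mf B mB; exact: mf _ (mg B mB). Qed.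

Section Sends.
Context (U W : choiceType) (I : indexing_system U W).

Lemma sends_id (a : {fset U}) (i : W) : i \in I a -> sends I (finj_id a) i i.
Proof. by move=> ia; exists ia; rewrite is_map_id. Qed.

Lemma sends_incl (b a : {fset U}) (ba : b `<=` a) (i : W) :
  i \in I b -> sends I (finj_incl ba) i i.
Proof. by move=> ib; exists ib; rewrite is_incl. Qed.

Lemma sends_eq (b a : {fset U}) (t : finj b a) (ib : I b) (ia : I a) :
  sends I t (val ib) (val ia) -> is_map I t ib = ia.
Proof.
move=> [ib' e]; apply: val_inj; rewrite -e.
by congr (fsval (is_map I t _)); exact: val_inj.
Qed.

Lemma sends_comp (c b a : {fset U}) (s : finj b a) (t : finj c b)
    (i i' i'' : W) :
  sends I t i i' -> sends I s i' i'' -> sends I (finj_comp s t) i i''.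
Proof.
move=> [ic ti] [ib si']; exists ic; rewrite is_comp -si' /=.
by congr (fsval (is_map I s _)); exact: val_inj.
Qed.

Lemma sends_cancel (c b a : {fset U}) (s : finj b a) (t : finj c b)
    (i i' i'' : W) : i' \in I b ->
  sends I s i' i'' -> sends I (finj_comp s t) i i'' -> sends I t i i'.
Proof.
move=> ib [ib' si'] [ic]; rewrite is_comp -si' /= => e; exists ic.
by have /finj_inj -> := val_inj e.
Qed.

(** [sends_bij] shrinks the injection to a bijection onto its range, and its inverse carries [i']
    back to [i]. *)
Lemma iequiv_sym (i i' : indexT I) : iequiv i i' -> iequiv i' i.
Proof.
by move=> [b [a [t /sends_bij [c [_ [s' [_ _ s'i]]]]]]]; exists c, (idom i), s'.
Qed.

(** Since [t] factors through its range [c], the index [i] lies in [I c], so [idom i] is contained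
    in [c]; equivalent indices have equal arity, so the cardinalities agree. *)
Lemma sends_range (i j : indexT I) (a : {fset U}) (t : finj (idom j) a) :
  sends I t j i -> [fset fsval (t x) | x : idom j] = idom i.
Proof.
move=> ti; set c := [fset _ | _ : _].
have ca : c `<=` a by apply/fsubsetP => _ /imfsetP[x _ ->]; exact: fsvalP.
have hc (x : idom j) : fsval (t x) \in c by apply/imfsetP; exists x.
have t0_inj : injective (fun x : idom j => [` hc x]).
  by move=> x y /(congr1 val) /= /val_inj /finj_inj.
pose t0 : finj (idom j) c := Finj t0_inj.
have ic : ival i \in I c.
  case: ti => jd <-.
  have -> : t = finj_comp (finj_incl ca) t0 by apply: finjP => x; exact: val_inj.
  by rewrite is_comp /= is_incl; exact: fsvalP.
apply/esym/eqP; rewrite eqEfcard idom_sub //=.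
have -> : #|` c| = arity j.
  rewrite card_imfset /=; first by rewrite -cardE -cardfE.
  by move=> x y /val_inj /finj_inj.
by rewrite (@arity_equiv _ _ I j i) //; exists (idom j), a, t.
Qed.

(** Both ranges are [idom i], so [p] can be taken as [t] followed by the inverse of [t'] on that
    range; injectivity of [is_map I t'] then gives that [p] fixes [j]. *)
Lemma sends_stab (i j : indexT I) (a : {fset U}) (t t' : finj (idom j) a) :
  sends I t j i -> sends I t' j i ->
  exists2 p : finj (idom j) (idom j), stab p & t = finj_comp t' p.
Proof.
move=> ti t'i.
have tt' (x : idom j) : exists y : idom j, t' y = t x.
  have : fsval (t x) \in idom i.
    by rewrite -(sends_range ti); apply/imfsetP; exists x.
  rewrite -(sends_range t'i) => /imfsetP[y _ e].
  by exists y; exact: val_inj.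
have [p pE] := choice tt'.
have p_inj : injective p.
  by move=> x y e; apply: (@finj_inj _ _ _ t); rewrite -!pE e.
have tE : t = finj_comp t' (Finj p_inj) by apply: finjP => x /=; rewrite pE.
exists (Finj p_inj) => //; split; first exact: injF_bij.
by apply: (sends_cancel (idom_mem j) t'i); rewrite -tE.
Qed.

(** With a variable [c] in place of [[k]], the equation with [idom j] can be eliminated. *)
Lemma sends_stab_cast (i j : indexT I) (c a : {fset U}) (e : idom j = c)
    (t t' : finj c a) :
  sends I t j i -> sends I t' j i ->
  exists2 p : finj (idom j) (idom j), stab p &
    t = finj_comp t' (ecast c (finj c c) e p).
Proof. by case: c / e t t' => t t'; exact: sends_stab. Qed.

Lemma stab_cast_sends (j : indexT I) (c : {fset U}) (e : idom j = c)
    (p : finj (idom j) (idom j)) :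
  stab p -> sends I (ecast c (finj c c) e p) j j.
Proof. by case: c / e => -[]. Qed.

End Sends.

Section Family.
Context (U : labels) (W : choiceType) (D : data_structure U) (X : mspace)
  (I : indexing_system U W).

Lemma invariant_sends (S : representatives I) (f : comp_family D X S)
    (j : rep_set S) (i : indexT I) (a : {fset U})
    (t t' : finj (segment U (arity (val j))) a) (x : D a) :
  is_invariant f -> sends I t (val j) i -> sends I t' (val j) i ->
  f j (ds_map t x) = f j (ds_map t' x).
Proof.
move=> fI ti t'i; have [p sp ->] := sends_stab_cast (rep_domE j) ti t'i.
by rewrite ds_comp [in RHS]((fI j).2 p sp).
Qed.

(** Absorbs the arity cast, the transport and the inclusion into a single injection [t]; [of_family]
    is handled below only through this form. *)
Lemma of_family_sends (S : skeleton I) (f : comp_family D X S)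
    (a : {fset U}) (i : I a) :
  exists2 t : finj (segment U (arity (val (rep S (index_of i))))) a,
    sends I t (val (rep S (index_of i))) (val i) &
    forall x, of_family f x i = f (rep S (index_of i)) (ds_map t x).
Proof.
rewrite /of_family; set i' := index_of i.
set inc := finj_incl _; have incP : sends I inc i' (val i).
  exact: sends_incl (idom_mem i').
move: (arity_rep S i') (tr (sk_tr S) i') (tr_sends (sk_tr S) i').
(* Once [f] is reduced to its component [g], the arity equation can be eliminated. *)
move: (f (rep S i')) => g e.
case: _ / e => /= t ti.
exists (finj_comp inc t); first exact: sends_comp ti incP.
by move=> x; rewrite ds_comp.
Qed.

(** Both [rep S i] and [j] represent the class of [i], so uniqueness applies. *)
Lemma rep_sends (S : representatives I) (j : rep_set S) (i : indexT I)
    (b a : {fset U}) (t : finj b a) : sends I t (val j) i -> rep S i = j.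
Proof.
move=> ti; apply: val_inj; have [k [_ kU]] := rep_uniq S i.
rewrite -(kU (val (rep S i))); last by split; [exact: set_valP|exact: rep_equiv].
apply: kU; split; first exact: set_valP.
by apply: iequiv_sym; exists b, a, t.
Qed.

(** Invariance allows the injection built from the transport to be replaced by any other one sending
    [j] to [i]. *)
Lemma of_familyE (S : skeleton I) (f : comp_family D X S) (j : rep_set S)
    (a : {fset U}) (i : I a) (t : finj (segment U (arity (val j))) a) (x : D a) :
  is_invariant f -> sends I t (val j) (val i) ->
  of_family f x i = f j (ds_map t x).
Proof.
move=> fI ti; have [t' t'i ->] := of_family_sends f i.
have e : rep S (index_of i) = j := rep_sends (i := index_of i) ti.
case: _ / e t ti => t ti.
exact: (invariant_sends (i := index_of i)).
Qed.

Lemma to_family_invariant (S : representatives I)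
    (eta : forall a : {fset U}, D a -> array X I a) :
  is_natural eta -> is_invariant (to_family (S := S) eta).
Proof.
move=> [etam etaN] j; split.
  exact: (mmap_comp (@mmap_coord _ _ [` rep_mem j]) (etam _)).
move=> p sp; apply/funext => x; rewrite /to_family /= etaN /= /array_map /=.
(* Naturality has turned precomposition with [D[p]] into reading the coordinate [I[p](j)], which is
   [j]. *)
congr (eta _ x _); apply/esym/sends_eq => /=; exact: stab_cast_sends.
Qed.

Lemma of_family_natural (S : skeleton I) (f : comp_family D X S) :
  is_invariant f -> is_natural (of_family f).
Proof.
move=> fI; split=> [a|b a t x].
  apply: mmap_power => i; have [t _ tE] := of_family_sends f i.
  by rewrite (funext tE); exact: mmap_comp (fI _).1 (ds_mmap t).
apply/funext => i; have [s si ->] := of_family_sends f i.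
(* As [s] sends [r(i)] to [i], the composite of [t] and [s] sends [r(i)] to [I[t](i)] and computes
   that coordinate over [a]. *)
rewrite -ds_comp; apply/esym/of_familyE => //.
apply: sends_comp si _; exists (fsvalP i).
by congr (fsval (is_map I t _)); exact: val_inj.
Qed.

Lemma to_familyK (S : skeleton I)
    (eta : forall a : {fset U}, D a -> array X I a) :
  is_natural eta -> of_family (to_family (S := S) eta) = eta.
Proof.
move=> [_ etaN]; apply: functional_extensionality_dep => a.
apply/funext => x; apply/funext => i.
have [t ti ->] := of_family_sends (to_family (S := S) eta) i.
(* Naturality along [t] moves the coordinate [r(i)] over [[k]] to the coordinate [I[t](r(i))], which
   is [i], over [a]. *)
rewrite /to_family etaN /= /array_map /=.
by congr (eta a x _); exact: sends_eq.
Qed.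

Lemma of_familyK (S : skeleton I) (f : comp_family D X S) :
  is_invariant f -> to_family (of_family f) = f.
Proof.
move=> fI; apply: functional_extensionality_dep => j; apply/funext => x.
(* The identity of [[k]] sends [j] to itself, so it can stand in for the chosen transport. *)
rewrite /to_family (@of_familyE _ _ j _ _ (finj_id _)) ?ds_id //=.
exact: sends_id (rep_mem j).
Qed.

Lemma of_family_transports (S : skeleton I) (p' : transports S)
    (f : comp_family D X S) :
  is_invariant f ->
  of_family (S := Skeleton p') f = of_family (S := S) f.
Proof.
move=> fI; apply: functional_extensionality_dep => a.
apply/funext => x; apply/funext => i.
(* The injection [t] obtained from the transports of [S] is equally admissible in [of_familyE] for
   [p']. *)
have [t ti ->] := of_family_sends (S := S) f i.
exact: of_familyE.
Qed.

End Family.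

Theorem theorem12 (R : realType) (U : labels) (W : choiceType)
    (D : BDS R U) (X : mspace) (hX : borel_space R X)
    (I : indexing_system U W) (S : skeleton I) :
  [/\ forall eta : (forall a : {fset U}, bds_ds D a -> array X I a),
        is_natural eta -> is_invariant (to_family (S := S) eta),
      forall f : comp_family D X S,
        is_invariant f -> is_natural (of_family f),
      forall eta : (forall a : {fset U}, bds_ds D a -> array X I a),
        is_natural eta -> of_family (to_family (S := S) eta) = eta,
      forall f : comp_family D X S,
        is_invariant f -> to_family (of_family f) = f &
      forall (p' : transports S) (f : comp_family D X S),
        is_invariant f ->
        of_family (S := Skeleton p') f = of_family (S := S) f].
Proof.
split.
- exact: to_family_invariant.
- exact: of_family_natural.
- exact: to_familyK.
- exact: of_familyK.
- exact: of_family_transports.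
Qed.
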